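(* Let $\mathbf{u}\in\mathbb{R}^3$ be a fixed unit vector and let $\mathbf{o}_T,\mathbf{o}_R$ be independent random vectors, each uniformly distributed on the unit sphere $\mathcal{S}\subset\mathbb{R}^3$. Let $$J_{NF}=\mathbf{o}_R^{\mathsf T}\,\tfrac12\left(3\mathbf{u}\mathbf{u}^{\mathsf T}-\mathbf{I}_3\right)\mathbf{o}_T,\qquad J_{FF}=\mathbf{o}_R^{\mathsf T}\left(\mathbf{I}_3-\mathbf{u}\mathbf{u}^{\mathsf T}\right)\mathbf{o}_T .$$ Then $J_{NF}$ has the probability density function $$f_{J_{NF}}(y)=\frac{1}{2\bar\beta}\cdot\begin{cases}1, & |y|\le \tfrac12,\\[1mm] 1-\dfrac{\operatorname{arcosh}(2|y|)}{\operatorname{arcosh}(2)}, & \tfrac12<|y|<1,\\[1mm] 0, & |y|\ge 1,\end{cases}\qquad \bar\beta=\frac{\sqrt3}{2\operatorname{arcosh}(2)},$$ and $J_{FF}$ has the probability density function $$f_{J_{FF}}(y)=\frac12\left(\frac{\pi}{2}-\arcsin|y|\right)\ \text{ for } y\in[-1,1],\qquad f_{J_{FF}}(y)=0\ \text{ otherwise.}$$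
   Context: $\mathbf{I}_3$ is the $3\times 3$ identity matrix. $J_{NF}$ and $J_{FF}$ are called the near-field and far-field alignment factors of the link between a transmit dipole with orientation $\mathbf{o}_T$ and a receive dipole with orientation $\mathbf{o}_R$; $\mathbf{u}$ is the transmitter-to-receiver direction. *)

(* Defs.v *)
(* MathComp-Analysis, over an arbitrary [R : realType]. *)
From HB Require Import structures.
From mathcomp Require Import all_boot all_order all_algebra.
From mathcomp Require Import all_classical all_reals all_analysis.

Set Implicit Arguments.
Unset Strict Implicit.
Unset Printing Implicit Defensive.

Import Order.TTheory GRing.Theory Num.Theory.
Import numFieldNormedType.Exports.

Local Open Scope classical_set_scope.
Local Open Scope ring_scope.

(* Column vectors with their Borel sigma-algebra. The library norm on matrices
   is the max norm, which induces the same topology as the Euclidean one but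
   cannot be used to say "unit vector"; hence [enorm]. *)
Definition borel3 (R : realType) :=
  g_sigma_algebraType (@open 'cV[R]_3).

Definition enorm (R : realType) n (v : 'cV[R]_n) : R :=
  Num.sqrt (\sum_i v i 0 ^+ 2).

(* The point of the unit sphere with polar angle [theta] in [0, pi] and
   azimuth [phi] in [0, 2 pi]. *)
Definition sphere_point (R : realType) (theta phi : R) : 'cV[R]_3 :=
  \col_i [:: sin theta * cos phi; sin theta * sin phi; cos theta]`_i.

(* Surface area of [A] intersected with the unit sphere: the area element of
   the parametrisation [sphere_point] is
   |d_theta x d_phi| = sin theta dtheta dphi. *)
Definition sphere_area (R : realType) (A : set 'cV[R]_3) : \bar R :=
  (\int[lebesgue_measure]_(theta in `[0%R, pi])
    \int[lebesgue_measure]_(phi in `[0%R, (2 * pi)%R])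
      (\1_A (sphere_point theta phi) * sin theta)%:E)%E.

(* The law of [X] is the surface measure divided by the total area [4 * pi]. *)
Definition uniform_on_sphere d (T : measurableType d) (R : realType)
    (P : probability T R) (X : {RV P >-> borel3 R}) : Prop :=
  forall A : set (borel3 R), measurable A ->
    distribution P X A = (((4 * pi)^-1)%:E * sphere_area A)%E.

Definition independent_RV d d1 d2 (T : measurableType d)
    (T1 : measurableType d1) (T2 : measurableType d2) (R : realType)
    (P : probability T R) (X : {RV P >-> T1}) (Y : {RV P >-> T2}) : Prop :=
  forall (A : set T1) (B : set T2), measurable A -> measurable B ->
    P (X @^-1` A `&` Y @^-1` B) = (P (X @^-1` A) * P (Y @^-1` B))%E.

Definition has_pdf d (T : measurableType d) (R : realType)
    (P : probability T R) (X : T -> R) (f : R -> R) : Prop :=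
  [/\ measurable_fun [set: T] X,
      measurable_fun [set: R] f,
      (forall y, 0 <= f y) &
      forall A : set R, measurable A ->
        P (X @^-1` A) = (\int[lebesgue_measure]_(y in A) (f y)%:E)%E].

Definition J_NF (R : realType) (u oT oR : 'cV[R]_3) : R :=
  (oR^T *m (2^-1 *: (3 *: (u *m u^T) - 1%:M)) *m oT) 0 0.

Definition J_FF (R : realType) (u oT oR : 'cV[R]_3) : R :=
  (oR^T *m (1%:M - u *m u^T) *m oT) 0 0.

(* Inverse of cosh on [1, +oo); only used at arguments [>= 1]. *)
Definition arcosh (R : realType) (x : R) : R :=
  ln (x + Num.sqrt (x ^+ 2 - 1)).

Definition beta_bar (R : realType) : R := Num.sqrt 3 / (2 * arcosh 2).

Definition f_NF (R : realType) (y : R) : R :=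
  (2 * beta_bar R)^-1 *
  (if `|y| <= 2^-1 then 1
   else if `|y| < 1 then 1 - arcosh (2 * `|y|) / arcosh 2
   else 0).

Definition f_FF (R : realType) (y : R) : R :=
  if -1 <= y <= 1 then 2^-1 * (pi / 2 - asin `|y|) else 0.

(* Main.v *)
(* [J] is [(x, y) |-> (N x) . y] with [N] a symmetric matrix such that, for
   [x] on the sphere, the norm of [N x] is a function [g] of [a = u . x].  By
   Archimedes' theorem the projection of a uniform point of the sphere on a fixed
   axis is uniform on [-1, 1].  Applied to [o_R] this says that, given [o_T], the
   variable [J] is uniform on [-g(a), g(a)]; applied to [o_T] it says that [a] is
   uniform on [-1, 1].  Hence, by Tonelli, [J] has the density
   [y |-> 1/4 \int_{-1}^1 1(|y| < g(a)) / g(a) da], which is computed with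
   [g(a) = sqrt(1 + 3 a^2) / 2] (near field) and [g(a) = sqrt(1 - a^2)]
   (far field). *)
Require Import Defs.
From HB Require Import structures.
From mathcomp Require Import all_boot all_order all_algebra.
From mathcomp Require Import all_classical all_reals all_analysis.
From mathcomp Require Import measurable_realfun ring lra.

Set Implicit Arguments.
Unset Strict Implicit.
Unset Printing Implicit Defensive.

Import Order.TTheory GRing.Theory Num.Theory.
Import numFieldNormedType.Exports.

Local Open Scope classical_set_scope.
Local Open Scope ring_scope.

(** * Measures with a density *)

(** For any other unit axis the rotation is replaced by a symmetry: the joint weight of the heights
    along the pole and along the axis does not change when the two heights are exchanged.

    The integrands are unbounded or discontinuous, so the basic substitutions are proved as
    identities of measures, checked on intervals or rays, and then carried to all nonnegative
    measurable functions. Since square roots of negative numbers and the inverse of 0 are 0, arcsine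
    weights vanish by themselves outside their supports, and Tonelli can run over the whole line.

    The near-field gain lies between 1/2 and 1 for [|a| <= 1], so [|y| < 1/2] excludes no [a]. Hence
    the plateau, of height the integral of [1 / sqrt (1 + 3 a^2)] over [0, 1], which is
    [arcosh 2 / sqrt 3]. In the far field [a = cos x] gives the gain [sin x], which cancels the
    Jacobian and leaves only a length to compute. *)

Section density.
Local Open Scope ereal_scope.
Context d (T : measurableType d) (R : realType).
Variables (mu : {measure set T -> \bar R}) (w : T -> R).

(* The hypotheses are arguments of the definition so that its measure structure
   can be inferred. *)
Definition density_measure of
    measurable_fun [set: T] w & (forall x, 0 <= w x)%R :=
  fun A : set T => \int[mu]_(x in A) (w x)%:E.

Hypotheses (mw : measurable_fun [set: T] w) (w0 : forall x, (0 <= w x)%R).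
Local Notation nu := (density_measure mw w0).

Let nu0 : nu set0 = 0. Proof. exact: integral_set0. Qed.

Let nu_ge0 A : 0 <= nu A.
Proof. by apply: integral_ge0 => x _; rewrite lee_fin. Qed.

Let nu_sigma_additive : semi_sigma_additive nu.
Proof.
apply: semi_sigma_additive_nng_induced; first exact/measurable_EFinP.
by move=> x; rewrite lee_fin.
Qed.

HB.instance Definition _ :=
  isMeasure.Build _ _ _ nu nu0 nu_ge0 nu_sigma_additive.

Import HBNNSimple.

(** Monotone convergence along simple functions increasing to [G], applied to both sides, and then
    linearity reduce the claim to indicators, for which it is the definition of
    [density_measure]. *)
Lemma integral_density (G : T -> \bar R) :
  measurable_fun [set: T] G -> (forall x, 0 <= G x) ->
  \int[nu]_x G x = \int[mu]_x (G x * (w x)%:E).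
Proof.
move=> mG G0; pose h := nnsfun_approx measurableT mG.
have wE0 x : 0 <= (w x)%:E by rewrite lee_fin.
have mwE : measurable_fun [set: T] (EFin \o w) by exact/measurable_EFinP.
have -> : \int[nu]_x G x = limn (fun n => \int[nu]_x (h n x)%:E).
  rewrite -monotone_convergence//.
  - by apply: eq_integral => x _; apply/esym/cvg_lim => //; exact: cvg_nnsfun_approx.
  - by move=> n; exact/measurable_EFinP.
  - by move=> n x _; rewrite lee_fin.
  - by move=> x _ m n mn; rewrite lee_fin; exact/lefP/nd_nnsfun_approx.
have -> : \int[mu]_x (G x * (w x)%:E) =
    limn (fun n => \int[mu]_x ((h n x)%:E * (w x)%:E)).
  rewrite -monotone_convergence//.
  - apply: eq_integral => x _; apply/esym/cvg_lim => //.
    by apply: cvgeZr => //; exact: cvg_nnsfun_approx.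
  - by move=> n; apply: emeasurable_funM => //; exact/measurable_EFinP.
  - by move=> n x _; rewrite mule_ge0 ?lee_fin.
  - move=> x _ m n mn; rewrite lee_wpmul2r// lee_fin.
    exact/lefP/nd_nnsfun_approx.
congr (limn _); apply/funext => n.
transitivity (\int[nu]_x
    (\sum_(y \in range (h n)) (y * \1_(h n @^-1` [set y]) x)%:E)).
  by apply: eq_integral => x _; rewrite fimfunE -fsumEFin.
transitivity (\int[mu]_x
    (\sum_(y \in range (h n)) ((y * \1_(h n @^-1` [set y]) x)%:E * (w x)%:E)));
    last first.
  apply: eq_integral => x _; rewrite fimfunE -fsumEFin// ge0_mule_fsuml//.
  by move=> y; exact: nnfun_muleindic_ge0.
rewrite !ge0_integral_fsum//=; last 4 first.
- move=> y; apply: emeasurable_funM => //; apply/measurable_EFinP.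
  by apply: measurable_funM.
- by move=> y x _; rewrite mule_ge0//; exact: nnfun_muleindic_ge0.
- by move=> y; apply/measurable_EFinP; apply: measurable_funM.
- by move=> y x _; exact: nnfun_muleindic_ge0.
apply: eq_fsbigr => r; rewrite inE => -[t _ <-].
set B := h n @^-1` _.
have mB : measurable B by rewrite -[B]setTI; exact: measurable_funP.
have mB1 : measurable_fun [set: T] (fun x => (\1_B x : R)%:E).
  exact/measurable_EFinP.
have B1 x : 0 <= (\1_B x : R)%:E by rewrite lee_fin.
have t0 : 0 <= (h n t)%:E by rewrite lee_fin.
transitivity ((h n t)%:E * \int[nu]_x (\1_B x)%:E).
  by rewrite -ge0_integralZl//; apply: eq_integral => x _; rewrite EFinM.
transitivity ((h n t)%:E * \int[mu]_x ((\1_B x)%:E * (w x)%:E)); last first.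
  rewrite -ge0_integralZl//; last 2 first.
  - exact: emeasurable_funM.
  - by move=> x _; rewrite mule_ge0.
  by apply: eq_integral => x _; rewrite muleA.
congr (_ * _); rewrite integral_indic// setIT.
rewrite /density_measure/= [LHS]integral_mkcond; apply: eq_integral => x _.
by rewrite muleC epatch_indic.
Qed.

(** The hypothesis on sets makes [m2] the image under [phi] of the measure with density [w]. A
    change of variables for integrals thus only has to be checked on measurable sets. *)
Lemma integral_transport d2 (T2 : measurableType d2)
    (m2 : {measure set T2 -> \bar R}) (phi : T -> T2) (G : T2 -> \bar R) :
  measurable_fun [set: T] phi ->
  (forall A, measurable A -> m2 A = \int[mu]_(x in phi @^-1` A) (w x)%:E) ->
  measurable_fun [set: T2] G -> (forall x, 0 <= G x) ->
  \int[m2]_y G y = \int[mu]_x (G (phi x) * (w x)%:E).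
Proof.
move=> mphi m2E mG G0.
rewrite (@eq_measure_integral _ _ _ _ (pushforward nu phi)); last first.
  by move=> A mA _; exact: m2E.
rewrite ge0_integral_pushforward// preimage_setT integral_density//.
- exact: measurableT_comp.
- by move=> x; exact: G0.
Qed.

End density.

(** * Changes of variables *)

Section change_of_variables.
Local Open Scope ereal_scope.
Context {R : realType}.
Local Notation mu := (@lebesgue_measure R).

Lemma measurable_affine m k : measurable_fun [set: R] (fun x => m + k * x)%R.
Proof.
apply: continuous_measurable_fun => x.
by apply: cvgD; [exact: cvg_cst|apply: cvgM; [exact: cvg_cst|exact: cvg_id]].
Qed.

(** Lebesgue measure is determined by its values on the intervals []a, b]]. Their preimages are open
    on the left for [k > 0] and on the right for [k < 0], hence the two cases. *)
Lemma lebesgue_measure_affine (m k : R) (A : set R) : k != 0%R ->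
  measurable A -> mu A = `|k|%:E * mu ((fun x => m + k * x)%R @^-1` A).
Proof.
move=> k0 mA.
pose phi (x : R) : measurableTypeR R := (m + k * x)%R.
have mphi : measurable_fun [set: R] phi by exact: measurable_affine.
have nk0 : (0 <= `|k|)%R by [].
pose nu := pushforward (mscale (NngNum nk0) mu) phi.
transitivity (nu A); last by [].
apply: lebesgue_measure_unique mA => _ [[a b]] _ <-.
transitivity (`|k|%:E * mu (phi @^-1` `]a, b]%classic)); last by [].
have [k1|k1] := ltP 0%R k.
- rewrite (_ : phi @^-1` _ = `]((a - m) / k)%R, ((b - m) / k)%R]%classic); last first.
    apply/seteqP; split => x; rewrite /phi/= !in_itv/=.
      by rewrite ltr_pdivrMr// ler_pdivlMr// ltrBlDl lerBrDl ![(x * k)%R]mulrC.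
    by rewrite ltr_pdivrMr// ler_pdivlMr// ltrBlDl lerBrDl ![(x * k)%R]mulrC.
  rewrite !lebesgue_measure_itv/= !lte_fin ltr_pM2r ?invr_gt0// ltrD2r.
  case: ifPn => _; last by rewrite mule0.
  rewrite -!EFinD -EFinM gtr0_norm//; congr EFin; rewrite -mulrBl mulrC divfK//.
  by rewrite opprB addrA subrK.
- have {k1}k1 : (k < 0)%R by rewrite lt_neqAle k0.
  rewrite (_ : phi @^-1` _ = `[((b - m) / k)%R, ((a - m) / k)%R[%classic); last first.
    apply/seteqP; split => x; rewrite /phi/= !in_itv/=.
      by rewrite ltr_ndivlMr// ler_ndivrMr// ltrBlDl lerBrDl ![(x * k)%R]mulrC andbC.
    by rewrite ltr_ndivlMr// ler_ndivrMr// ltrBlDl lerBrDl ![(x * k)%R]mulrC andbC.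
  rewrite !lebesgue_measure_itv/= !lte_fin ltr_nM2r ?invr_lt0// ltrD2r.
  case: ifPn => _; last by rewrite mule0.
  rewrite -!EFinD -EFinM ltr0_norm//; congr EFin.
  rewrite -mulrBl mulNr mulrC divfK// opprB.
  by rewrite opprB addrA subrK.
Qed.

Lemma integral_affine (m k : R) (G : R -> \bar R) : k != 0%R ->
  measurable_fun [set: R] G -> (forall x, 0 <= G x) ->
  \int[mu]_x G x = `|k|%:E * \int[mu]_x G (m + k * x)%R.
Proof.
move=> k0 mG G0.
have mphi := measurable_affine m k.
rewrite (@integral_transport _ _ _ mu (cst `|k|%R) _ _ _ _ mu
  (fun x => m + k * x)%R)//; last first.
  move=> A mA; apply: etrans (lebesgue_measure_affine m k0 mA) _.
  apply/esym/(integral_cst _ _ `|k|%:E).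
  by rewrite -[X in measurable X]setTI; exact: mphi.
rewrite -ge0_integralZl//; last exact: (measurableT_comp mG mphi).
by apply: eq_integral => x _; rewrite muleC.
Qed.

Lemma integral_sin_itv (a : R) : (0 <= a < pi)%R ->
  \int[mu]_(x in `[a, pi]) (sin x)%:E = (cos a + 1)%:E.
Proof.
move=> /andP[a0 api].
have dF (x : R) : is_derive x 1%R (fun t : R => - cos t)%R (sin x).
  by apply: is_derive_eq; rewrite opprK.
rewrite (@continuous_FTC2 _ _ (fun t => - cos t)%R)//.
- by rewrite -EFinB cospi opprK opprK addrC.
- by apply: continuous_subspaceT => x; exact: continuous_sin.
- have cF : continuous (fun t : R => - cos t)%R.
    by move=> x; apply: cvgN; exact: continuous_cos.
  split => [x _||].
  - exact: ex_derive.
  - by apply: cvg_at_right_filter; exact: cF.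
  - by apply: cvg_at_left_filter; exact: cF.
- by move=> x _; rewrite derive1E; apply: derive_val.
Qed.

End change_of_variables.

(** * The substitution by the cosine on []0, pi[] *)

Section cosine_substitution.
Local Open Scope ereal_scope.
Context {R : realType}.
Local Notation mu := (@lebesgue_measure R).

Lemma measurable_cos : measurable_fun [set: R] (@cos R).
Proof. by apply: continuous_measurable_fun; exact: continuous_cos. Qed.

Lemma measurable_sin : measurable_fun [set: R] (@sin R).
Proof. by apply: continuous_measurable_fun; exact: continuous_sin. Qed.

Lemma integral_sin_oo (a : R) : (0 <= a < pi)%R ->
  \int[mu]_(x in `]a, pi[) (sin x)%:E = (cos a + 1)%:E.
Proof.
move=> api; rewrite -integral_sin_itv// -(@integral_itv_bndoo _ _ _ _ true false)//.
by apply/measurable_EFinP; apply: measurable_funTS; exact: measurable_sin.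
Qed.

(** The Jacobian of the cosine, cut off outside []0, pi[] because the weight of a [density_measure]
    must be nonnegative on the whole line. *)
Let w (x : R) : R := (sin x * \1_(`]0%R, pi[%classic : set R) x)%R.

Let mw : measurable_fun [set: R] w.
Proof. by apply: measurable_funM => //; exact: measurable_sin. Qed.

Let w0 x : (0 <= w x)%R.
Proof.
rewrite /w indicE; case: (boolP (_ \in _)); last by rewrite mulr0.
by rewrite inE/= in_itv/= => xpi; rewrite mulr1 ltW// sin_gt0_pi.
Qed.

Let wE (A : set R) :
  \int[mu]_(x in A) (w x)%:E = \int[mu]_(x in A `&` `]0%R, pi[) (sin x)%:E.
Proof.
by rewrite integral_mkcondr; apply: eq_integral => x _; rewrite epatch_indic.
Qed.

(** The cosine decreases on [[0, pi]], so [cos x < b] reads [acos b < x]. The minimum with 1 is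
    there because [acos] inverts the cosine on [[-1, 1]] only. *)
Let cos_lt_preimage (b : R) : (-1 < b)%R ->
  (cos @^-1` `]-oo, b[) `&` `]0%R, pi[ = `]acos (Num.min b 1)%R, pi[%classic :> set R.
Proof.
move=> b1; set c := Num.min b 1%R.
have c1 : (-1 <= c <= 1)%R.
  by rewrite /c le_min ge_min lexx orbT (ltW b1)/= andbT; lra.
apply/seteqP; split => x; rewrite /= !in_itv/=.
  move=> [xb /andP[x0 xpi]]; rewrite xpi andbT ltNge; apply/negP => xa.
  have : (cos (acos c) <= cos x)%R.
    rewrite leNgt ltr_cos ?in_itv/= ?acos_ge0 ?acos_lepi ?(ltW x0) ?(ltW xpi)//.
    by rewrite -leNgt.
  rewrite acosK ?in_itv//=; rewrite /c ge_min => /orP[bx|x1].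
    by move: xb; rewrite ltNge bx.
  have : (cos x < cos 0)%R.
    by rewrite ltr_cos ?in_itv/= ?lexx ?pi_ge0 ?(ltW x0) ?(ltW xpi).
  by rewrite cos0 ltNge x1.
move=> /andP[ax xpi]; have a0 : (0 <= acos c)%R by exact: acos_ge0.
have x0 := le_lt_trans a0 ax; split; last by rewrite x0.
have : (cos x < cos (acos c))%R.
  by rewrite ltr_cos ?in_itv/= ?acos_ge0 ?acos_lepi ?(ltW x0) ?(ltW xpi).
by rewrite acosK ?in_itv//= => /lt_le_trans; apply; rewrite /c ge_min lexx.
Qed.

(** Both sides are measures in [A], determined by their values on the rays []-oo, b[]. For [b > -1]
    both values are [Num.min b 1 + 1]; for [b <= -1] both are 0. *)
Let cos_law (A : set R) : measurable A ->
  mu (A `&` `](-1)%R, 1%R[) = \int[mu]_(x in cos @^-1` A) (w x)%:E.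
Proof.
move=> mA.
have mI : measurable (`](-1)%R, 1%R[%classic : set R) by exact: measurable_itv.
transitivity (mrestr mu mI A) => //.
pose phi : R -> measurableTypeR R := @cos R.
have mphi : measurable_fun [set: R] phi by exact: measurable_cos.
transitivity (pushforward (density_measure mu mw w0) phi A) => //.
pose G := @RGenInftyO.G R.
apply: (@measure_unique _ R (measurableTypeR R) G
  (fun k => `]-oo, k%:R[%classic)) => //.
- exact: RGenInftyO.measurableE.
- move=> _ _ [x ->] [y ->]; exists (Num.min x y); apply/seteqP.
  by split => z; rewrite /= !in_itv/= lt_min => /andP.
- by move=> k; exists k%:R.
- apply/seteqP; split => // x _; exists (Num.truncn `|x|).+1 => //=.
  by rewrite in_itv/= (le_lt_trans (ler_norm x))// truncnS_gt.
- move=> _ [b ->].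
  transitivity (\int[mu]_(x in (@cos R) @^-1` `]-oo, b[) (w x)%:E); last by [].
  transitivity (mu (`]-oo, b[ `&` `](-1)%R, 1%R[)); first by [].
  rewrite wE; have [b1|b1] := leP b (-1)%R.
    rewrite (_ : _ `&` _ = set0) ?measure0; last first.
      apply/seteqP; split => // x /= []; rewrite !in_itv/= => xb /andP[x1 _].
      by have := lt_trans x1 xb; rewrite ltNge b1.
    rewrite (_ : _ `&` _ = set0) ?integral_set0//.
    apply/seteqP; split => // x /= []; rewrite in_itv/= => xb _.
    by move: (cos_geN1 x); rewrite leNgt (lt_le_trans xb b1).
  have c1 : (-1 < Num.min b 1%R <= 1)%R.
    by rewrite lt_min ge_min lexx orbT b1/= andbT; lra.
  have c1' : (-1 <= Num.min b 1%R <= 1)%R by case/andP: c1 => /ltW -> ->.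
  rewrite cos_lt_preimage// integral_sin_oo ?acos_ge0 ?acos_ltpi//.
  rewrite acosK ?in_itv//=.
  rewrite (_ : _ `&` _ = `](-1)%R, (Num.min b 1)%R[%classic); last first.
    apply/seteqP; split => x; rewrite /= !in_itv/= lt_min.
      by move=> [-> /andP[-> ->]].
    by case/and3P => -> -> ->.
  rewrite lebesgue_measure_itv/= lte_fin; case/andP : c1 => -> _.
  by rewrite -EFinB opprK.
- move=> k; apply: (@le_lt_trans _ _ (mu `](-1)%R, 1%R[)).
    by apply: le_measure; rewrite ?inE//; exact: measurableI.
  by rewrite lebesgue_measure_itv/=; case: ifPn; rewrite ?ltry.
Qed.

Let restr_density (D : set R) (mD : measurable D) (G : R -> \bar R) (v : R -> R) :
  \int[mu]_(x in D) (G x * (v x)%:E) = \int[mu]_x (G x * (v x * \1_D x)%:E).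
Proof.
rewrite integral_mkcond; apply: eq_integral => x _.
by rewrite epatch_indic EFinM muleA.
Qed.

Lemma integral_cos_sin (G : R -> \bar R) :
  measurable_fun [set: R] G -> (forall x, 0 <= G x) ->
  \int[mu]_(z in `](-1)%R, 1%R[) G z =
  \int[mu]_(x in `]0%R, pi[) (G (cos x) * (sin x)%:E).
Proof.
move=> mG G0; pose I : set R := `](-1)%R, 1%R[%classic.
have mI : measurable I by exact: measurable_itv.
have m1 : measurable_fun [set: R] (\1_I : R -> R) by exact: measurable_indic.
have I0 x : (0 <= \1_I x :> R)%R by [].
transitivity (\int[density_measure mu m1 I0]_x G x).
  rewrite integral_density// [LHS]integral_mkcond.
  by apply: eq_integral => x _; rewrite epatch_indic.
rewrite (restr_density _ (fun x => G (cos x)))//.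
apply: (@integral_transport _ _ _ mu _ mw w0 _ _ (density_measure mu m1 I0)
  (@cos R)) => //; first exact: measurable_cos.
move=> A mA; rewrite -cos_law// -[A `&` _]setIC -integral_indic//.
Qed.

End cosine_substitution.

(** * Arcsine weights and integrals over a full turn *)

Section arcsine_and_rotation.
Local Open Scope ereal_scope.
Context {R : realType}.
Local Notation mu := (@lebesgue_measure R).
Implicit Types (m k a b c : R) (f h : R -> \bar R).

Lemma measurable_sqrtr : measurable_fun [set: R] (@Num.sqrt R).
Proof. by apply: continuous_measurable_fun; exact: sqrt_continuous. Qed.

Lemma measurable_invr : measurable_fun [set: R] (@GRing.inv R).
Proof.
rewrite -(setUv [set 0%R]); apply/measurable_funU => //.
  exact: measurableC.
split; first exact: measurable_fun_set1.
apply: subspace_continuous_measurable_fun; first exact: measurableC.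
rewrite (_ : ~` _ = [set x : R | x != 0%R]); last first.
  by apply/seteqP; split => x /= /eqP.
rewrite continuous_open_subspace; last exact: open_neq.
by move=> x; rewrite inE/= => x0; exact: inv_continuous.
Qed.

Lemma sqrt_inv_le0 (x : R) : (x <= 0)%R -> ((Num.sqrt x)^-1 = 0)%R.
Proof. by move=> x0; rewrite ler0_sqrtr// invr0. Qed.

(* Substituting [w = m + k cos phi].  The weight vanishes when [k <= |w - m|],
   because then [Num.sqrt] and the inverse return 0. *)
Lemma integral_arcsine m k h : (0 < k)%R ->
  measurable_fun [set: R] h -> (forall x, 0 <= h x) ->
  \int[mu]_(x in `]0%R, pi[) h (m + k * cos x)%R =
  \int[mu]_w (h w * ((Num.sqrt (k ^+ 2 - (w - m) ^+ 2))^-1)%:E).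
Proof.
move=> k0 mh h0; have mhk : measurable_fun [set: R] (fun z => h (m + k * z)%R).
  exact: (measurableT_comp mh (measurable_affine m k)).
rewrite (@integral_affine _ m k (fun w => h w * _)) ?gt_eqF//; last 2 first.
- apply: emeasurable_funM => //; apply/measurable_EFinP.
  apply: (measurableT_comp measurable_invr).
  apply: (measurableT_comp measurable_sqrtr).
  apply: measurable_funB => //; apply: measurable_funX.
  exact: measurable_funB.
- by move=> x; rewrite mule_ge0// lee_fin invr_ge0 sqrtr_ge0.
pose u (z : R) : R := ((Num.sqrt (1 - z ^+ 2))^-1)%R.
have mu' : measurable_fun [set: R] u.
  apply: (measurableT_comp measurable_invr).
  apply: (measurableT_comp measurable_sqrtr).
  by apply: measurable_funB => //; exact: measurable_funX.
have u0 z : (0 <= u z)%R by rewrite invr_ge0 sqrtr_ge0.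
have mhu : measurable_fun [set: R] (fun z => h (m + k * z)%R * (u z)%:E).
  by apply: emeasurable_funM => //; exact/measurable_EFinP.
transitivity (\int[mu]_(z in `](-1)%R, 1%R[) (h (m + k * z)%R * (u z)%:E)).
  rewrite integral_cos_sin//; last by move=> x; rewrite mule_ge0// lee_fin.
  apply: eq_integral => x; rewrite inE/= in_itv/= => x0pi.
  have sx0 := sin_gt0_pi x0pi.
  (* Here [u (cos x)] is [(sin x)^-1], which cancels the Jacobian. *)
  rewrite -muleA -EFinM /u -sin2cos2 sqrtr_sqr gtr0_norm// mulVf ?mule1//.
  by rewrite gt_eqF.
transitivity (\int[mu]_z (h (m + k * z)%R * (u z)%:E)).
  rewrite integral_mkcond; apply: eq_integral => z _; rewrite patchE.
  case: ifPn => // /negP zI; rewrite /u sqrt_inv_le0 ?mule0//.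
  rewrite subr_le0 leNgt; apply/negP => z1; apply: zI; rewrite inE/= in_itv/=.
  by apply/andP; split; nra.
rewrite gtr0_norm// -ge0_integralZl//; last 3 first.
- apply: emeasurable_funM => //; apply/measurable_EFinP.
  apply: (measurableT_comp measurable_invr).
  apply: (measurableT_comp measurable_sqrtr).
  apply: measurable_funB => //; apply: measurable_funX.
  by apply: measurable_funB => //; exact: measurable_affine.
- by move=> x _; rewrite mule_ge0// lee_fin invr_ge0 sqrtr_ge0.
- by rewrite lee_fin ltW.
apply: eq_integral => z _; rewrite muleCA -EFinM; congr (_ * _%:E).
rewrite addrAC subrr add0r exprMn -[X in (X - _)%R]mulr1 -mulrBr.
by rewrite sqrtrM ?sqr_ge0// sqrtr_sqr gtr0_norm// invfM mulVKf// gt_eqF.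
Qed.

Lemma ge0_integral_affine_in m k (D : set R) f : k != 0%R -> measurable D ->
  measurable_fun [set: R] f -> (forall x, 0 <= f x) ->
  \int[mu]_(x in D) f x =
  `|k|%:E * \int[mu]_(x in (fun x => m + k * x)%R @^-1` D) f (m + k * x)%R.
Proof.
move=> k0 mD mf f0.
rewrite integral_mkcond (@integral_affine _ m k)//; last 2 first.
- exact/(measurable_restrictT _ _).1/measurable_funTS.
- by move=> x; rewrite patchE; case: ifPn.
by rewrite [in RHS]integral_mkcond; congr (_ * _); apply: eq_integral => x _.
Qed.

Lemma ge0_integral_itv_split a b c f : (a <= b <= c)%R ->
  measurable_fun [set: R] f -> (forall x, 0 <= f x) ->
  \int[mu]_(x in `[a, c[) f x =
  \int[mu]_(x in `[a, b[) f x + \int[mu]_(x in `[b, c[) f x.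
Proof.
move=> /andP[ab bc] mf f0.
rewrite (@itv_bndbnd_setU _ _ (BLeft a) (BLeft b) (BLeft c)) ?bnd_simp//.
rewrite ge0_integral_setU//; first exact: measurable_funTS.
rewrite disj_set2E; apply/eqP/seteqP; split => // x /= [].
by rewrite !in_itv/= => /andP[_ xb] /andP[bx _]; move: xb; rewrite ltNge bx.
Qed.

(** The angle is [acos (x / s)], reflected to [2 * pi - acos (x / s)] when [y < 0]. Keeping it
    within one turn lets [integral_rotation] cut the shifted period at 0. *)
Lemma exists_polar (x y : R) : exists2 psi : R, (0 <= psi <= 2 * pi)%R &
  (x = Num.sqrt (x ^+ 2 + y ^+ 2) * cos psi /\
   y = Num.sqrt (x ^+ 2 + y ^+ 2) * sin psi)%R.
Proof.
set s := Num.sqrt _; have s2 : (s ^+ 2 = x ^+ 2 + y ^+ 2)%R.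
  by rewrite sqr_sqrtr// addr_ge0 ?sqr_ge0.
have s_ge0 : (0 <= s)%R by exact: sqrtr_ge0.
have [s0|s0] := eqVneq s 0%R.
  exists 0%R; first by rewrite lexx mulr_ge0// pi_ge0.
  rewrite s0 !mul0r; move: s2; rewrite s0 expr0n/= => /esym/eqP.
  by rewrite paddr_eq0 ?sqr_ge0// !sqrf_eq0 => /andP[/eqP -> /eqP ->].
have {s_ge0}s_gt0 : (0 < s)%R by rewrite lt_neqAle eq_sym s0.
pose t := (x / s)%R; have t1 : (-1 <= t <= 1)%R.
  rewrite /t ler_pdivlMr// ler_pdivrMr// mulN1r mul1r.
  by apply/andP; split; have := sqr_ge0 y; nra.
have sa : (s * sin (acos t) = `|y|)%R.
  rewrite sin_acos// /t -[X in (X * _)%R](gtr0_norm s_gt0).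
  rewrite -[X in (X * _)%R]sqrtr_sqr.
  rewrite -sqrtrM ?sqr_ge0// mulrBr mulr1 -exprMn mulrCA divff// mulr1 s2.
  by rewrite addrAC subrr add0r sqrtr_sqr.
have ca : (s * cos (acos t) = x)%R by rewrite acosK ?in_itv// /t mulrC divfK.
have [a0 api] : (0 <= acos t)%R /\ (acos t <= pi)%R.
  by rewrite acos_ge0 ?acos_lepi.
have p0 := pi_ge0 R.
have [y0|y0] := leP 0%R y.
  exists (acos t); first by rewrite a0/=; nra.
  by rewrite ca sa ger0_norm.
exists (2 * pi - acos t)%R; first by apply/andP; split; lra.
have -> : (2 * pi - acos t = - acos t + pi *+ 2)%R by rewrite mulr2n; ring.
rewrite cosD2pi sinD2pi cosN sinN ca mulrN sa.
by rewrite ltr0_norm ?opprK.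
Qed.

(** With [(x, y)] in polar form, [x cos t + y sin t = s cos (t - psi)]. The phase disappears over a
    full period, and the symmetry of the cosine about [pi] folds the period in two, which gives the
    factor 2. *)
Lemma integral_rotation (x y : R) h :
  measurable_fun [set: R] h -> (forall x, 0 <= h x) ->
  \int[mu]_(t in `[0%R, (2 * pi)%R]) h (x * cos t + y * sin t)%R =
  2%:E * \int[mu]_(t in `]0%R, pi[) h (Num.sqrt (x ^+ 2 + y ^+ 2) * cos t)%R.
Proof.
move=> mh h0; have [psi /andP[psi0 psi2] []] := exists_polar x y.
set s := Num.sqrt _ => xE yE; pose f t := h (s * cos t)%R.
have mf : measurable_fun [set: R] f.
  apply: (measurableT_comp mh); apply: measurable_funM => //.
  exact: measurable_cos.
have f0 t : 0 <= f t by exact: h0.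
have fN t : f (- t)%R = f t by rewrite /f cosN.
have fD t : f (2 * pi + t)%R = f t.
  by rewrite /f (_ : _ + t = t + pi *+ 2)%R ?cosD2pi// mulr2n; ring.
have p0 := pi_ge0 R.
transitivity (\int[mu]_(t in `[0%R, (2 * pi)%R[) f (- psi + 1 * t)%R).
  rewrite integral_itv_bndoo; last first.
    apply: measurable_funTS; apply: (measurableT_comp mh).
    by apply: measurable_funD; apply: measurable_funM => //;
      [exact: measurable_cos|exact: measurable_sin].
  rewrite [RHS]integral_itv_bndoo; last first.
    apply: measurable_funTS.
    exact: (measurableT_comp mf (measurable_affine _ _)).
  apply: eq_integral => t _; rewrite /f mul1r [(- psi + t)%R]addrC cosB {1}xE {1}yE; congr h.
  by rewrite mulrDr !mulrA [(s * cos _)%R]mulrC; ring.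
have -> : `[0%R, (2 * pi)%R[%classic =
    (fun t => - psi + 1 * t)%R @^-1`
      `[(- psi)%R, (2 * pi - psi)%R[%classic :> set R.
  by apply/seteqP; split => t; rewrite /= !in_itv/= => /andP[? ?];
    apply/andP; split; lra.
transitivity (\int[mu]_(t in `[(- psi)%R, (2 * pi - psi)%R[) f t).
  by rewrite [RHS](@ge0_integral_affine_in (- psi) 1)// normr1 mul1e.
(* The part of the shifted period to the left of 0 is moved by [2 * pi] and fills the gap between
   [2 * pi - psi] and [2 * pi]. *)
rewrite (@ge0_integral_itv_split _ 0%R)//; last by apply/andP; split; lra.
rewrite addeC.
transitivity (\int[mu]_(t in `[0%R, (2 * pi)%R[) f t).
  rewrite [RHS](@ge0_integral_itv_split _ (2 * pi - psi)%R)//; last first.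
    by apply/andP; split; lra.
  congr (_ + _).
  rewrite [RHS](@ge0_integral_affine_in (2 * pi) 1)// normr1 mul1e.
  rewrite (_ : _ @^-1` _ = `[(- psi)%R, 0%R[%classic); last first.
    by apply/seteqP; split => t; rewrite /= !in_itv/= => /andP[? ?];
      apply/andP; split; lra.
  by apply: eq_integral => t _; rewrite mul1r fD.
rewrite (@ge0_integral_itv_split _ pi)//; last by apply/andP; split; lra.
(* The reflection [t |-> 2 * pi - t] carries the second half of the period onto the first. *)
rewrite [X in _ + X](@ge0_integral_affine_in (2 * pi) (-1))//.
rewrite normrN1 mul1e (_ : _ @^-1` _ = `]0%R, pi]%classic); last first.
  by apply/seteqP; split => t; rewrite /= !in_itv/= => /andP[? ?];
    apply/andP; split; lra.
under [X in _ + X]eq_integral do rewrite fD mulN1r fN.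
rewrite [X in X + _]integral_itv_bndoo; last exact: measurable_funTS.
rewrite [X in _ + X]integral_itv_bndoo; last exact: measurable_funTS.
by rewrite -[X in X + _]mul1e -[X in _ + X]mul1e -ge0_muleDl// -EFinD.
Qed.

End arcsine_and_rotation.

(** * Archimedes' theorem *)

Section archimedes.
Local Open Scope ereal_scope.
Context {R : realType}.
Local Notation mu := (@lebesgue_measure R).

(** This is the weight of [integral_arcsine] with centre [c * z] and half-width
    [s * sqrt (1 - z^2)]. When [s^2 + c^2 = 1], the radicand is the Gram determinant of three unit
    vectors with inner products [c], [z], [w], which explains [kappaC]. *)
Let kappa (s c : R) (zw : R * R) : R :=
  ((Num.sqrt (s ^+ 2 * (1 - zw.1 ^+ 2) - (zw.2 - c * zw.1) ^+ 2))^-1)%R.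

Let measurable_kappa s c : measurable_fun [set: R * R] (kappa s c).
Proof.
apply: (measurableT_comp measurable_invr).
apply: (measurableT_comp measurable_sqrtr).
apply: measurable_funB.
  apply: measurable_funM => //; apply: measurable_funB => //.
  by apply: measurable_funX; exact: measurable_fst.
apply: measurable_funX; apply: measurable_funB; first exact: measurable_snd.
by apply: measurable_funM => //; exact: measurable_fst.
Qed.

Let kappa_ge0 s c zw : (0 <= kappa s c zw)%R.
Proof. by rewrite invr_ge0 sqrtr_ge0. Qed.

Let kappaC s c z w : (s ^+ 2 + c ^+ 2 = 1)%R -> kappa s c (z, w) = kappa s c (w, z).
Proof.
move=> /(canRL (addrK _)) sc; rewrite /kappa/= sc.
by congr ((Num.sqrt _)^-1)%R; ring.
Qed.

Let kappa_out s c z w : (1 <= z ^+ 2)%R -> kappa s c (z, w) = 0%R.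
Proof.
move=> z1; rewrite /kappa/= sqrt_inv_le0// subr_le0.
apply: (@le_trans _ _ 0%R); last exact: sqr_ge0.
by rewrite mulr_ge0_le0 ?sqr_ge0// subr_le0.
Qed.

Let sqr_lt1_itv (z : R) : (z \in `](-1)%R, 1%R[) = (z ^+ 2 < 1)%R.
Proof.
by rewrite in_itv/=; apply/andP/idP => [[]|]; [nra|split; nra].
Qed.

(** By [kappaC] the weight is also of arcsine type in [z], with centre [c * w]. Its mass is
    therefore the length [pi] of the range of angles, and it vanishes identically when
    [|w| >= 1]. *)
Let integral_kappa s c w : (0 < s)%R -> (s ^+ 2 + c ^+ 2 = 1)%R ->
  \int[mu]_z (kappa s c (z, w))%:E =
  (pi * \1_(`](-1)%R, 1%R[%classic : set R) w)%:E.
Proof.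
move=> s0 sc; rewrite indicE mem_setE sqr_lt1_itv; case: ltP => w1; last first.
  rewrite mulr0; apply: integral0_eq => z _.
  by rewrite kappaC// kappa_out.
have k0 : (0 < s * Num.sqrt (1 - w ^+ 2))%R.
  by rewrite mulr_gt0// sqrtr_gt0 subr_gt0.
have <- : \int[mu]_(x in `]0%R, pi[) (1 : \bar R) = (pi * 1)%:E.
  rewrite (integral_cst _ _ 1)//= lebesgue_measure_itv/= lte_fin pi_gt0.
  by rewrite sube0 mul1e mulr1.
rewrite [RHS](@integral_arcsine _ (c * w) _ (cst 1) k0)//.
apply: eq_integral => z _; rewrite mul1e kappaC// /kappa/=.
by rewrite exprMn sqr_sqrtr// subr_ge0 ltW.
Qed.

Let F (A : set R) s c (zw : R * R) : \bar R := (\1_A zw.2 * kappa s c zw)%:E.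

Let measurable_F A s c : measurable A -> measurable_fun [set: R * R] (F A s c).
Proof.
move=> mA; apply/measurable_EFinP; apply: measurable_funM => //.
by apply: measurableT_comp => //; exact: measurable_snd.
Qed.

Let F_ge0 A s c zw : 0 <= F A s c zw.
Proof. by rewrite lee_fin mulr_ge0. Qed.

Let integral_F A s c : measurable A -> (0 < s)%R -> (s ^+ 2 + c ^+ 2 = 1)%R ->
  \int[mu]_z \int[mu]_w F A s c (z, w) =
  pi%:E * mu (A `&` `](-1)%R, 1%R[).
Proof.
move=> mA s0 sc; rewrite fubini_tonelli//; last exact: measurable_F.
transitivity (\int[mu]_w (pi%:E * (\1_(A `&` `](-1)%R, 1%R[) w)%:E)).
  apply: eq_integral => w _; rewrite /F/=.
  under eq_integral do rewrite EFinM.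
  have mk : measurable_fun [set: R] (fun z => (kappa s c (z, w))%:E).
    apply/measurable_EFinP; apply: (measurableT_comp (measurable_kappa s c)).
    exact: pair2_measurable.
  rewrite ge0_integralZl//; last by move=> z _; rewrite lee_fin.
  rewrite integral_kappa// -!EFinM indicI/=; congr EFin.
  by rewrite mulrCA.
have mB : measurable (A `&` `](-1)%R, 1%R[) by exact: measurableI.
rewrite ge0_integralZl ?lee_fin ?pi_ge0//; last first.
  exact/measurable_EFinP/measurable_indic.
by rewrite integral_indic ?setIT.
Qed.

(** Agreement is asked on the open interval only: at the poles [sin theta = 0], so the arcsine law
    has zero half-width and [integral_arcsine] does not apply. *)
Let integral_polar (f G : R -> \bar R) :
  measurable_fun [set: R] G -> (forall z, 0 <= G z) ->
  {in `]0%R, pi[, forall x, f x = G (cos x) * (sin x)%:E} ->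
  \int[mu]_(x in `[0%R, pi]) f x = \int[mu]_(z in `](-1)%R, 1%R[) G z.
Proof.
move=> mG G0 fG; rewrite integral_cos_sin// integral_itv_bndoo.
  by apply: eq_integral => x; rewrite inE/= => /fG.
apply: (eq_measurable_fun (fun x => G (cos x) * (sin x)%:E)).
  by move=> x; rewrite inE/= => /fG.
apply: measurable_funTS; apply: emeasurable_funM.
  exact: (measurableT_comp mG measurable_cos).
by apply/measurable_EFinP; exact: measurable_sin.
Qed.

(* Archimedes: the projection of the uniform measure of the sphere on an axis
   is uniform.  After rotating the azimuth, [w = c cos theta + s sin theta cos
   phi] at fixed [z = cos theta] follows an arcsine law, whose density [kappa]
   is symmetric in [z] and [w] because [s^2 + c^2 = 1]; hence integrating it
   over [z] gives again the total mass of an arcsine law. *)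
Lemma sphere_projection (x y c : R) (A : set R) : measurable A ->
  (x ^+ 2 + y ^+ 2 + c ^+ 2 = 1)%R ->
  \int[mu]_(theta in `[0%R, pi]) \int[mu]_(phi in `[0%R, (2 * pi)%R])
    (\1_A (x * (sin theta * cos phi) + y * (sin theta * sin phi) +
           c * cos theta) * sin theta)%:E =
  (2 * pi)%:E * mu (A `&` `](-1)%R, 1%R[).
Proof.
move=> mA xyc; set s := Num.sqrt (x ^+ 2 + y ^+ 2).
have s2 : (s ^+ 2 = x ^+ 2 + y ^+ 2)%R by rewrite sqr_sqrtr// addr_ge0 ?sqr_ge0.
have sc : (s ^+ 2 + c ^+ 2 = 1)%R by rewrite s2.
have s_ge0 : (0 <= s)%R by exact: sqrtr_ge0.
have m1 (m k : R) :
    measurable_fun [set: R] (fun t => (\1_A (m + k * t))%:E : \bar R).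
  apply/measurable_EFinP; apply: (measurableT_comp (measurable_indic mA)).
  exact: measurable_affine.
have inner theta : theta \in `]0%R, pi[ ->
    \int[mu]_(phi in `[0%R, (2 * pi)%R])
    (\1_A (x * (sin theta * cos phi) + y * (sin theta * sin phi) +
           c * cos theta) * sin theta)%:E =
    2%:E * (\int[mu]_(phi in `]0%R, pi[)
       (\1_A (c * cos theta + s * sin theta * cos phi))%:E) * (sin theta)%:E.
  move=> theta0; have st0 : (0 < sin theta)%R by exact: sin_gt0_pi.
  pose h (t : R) : \bar R := (\1_A (c * cos theta + 1 * t))%:E.
  have mh : measurable_fun [set: R] h by exact: m1.
  have h0 t : 0 <= h t by rewrite lee_fin.
  have := integral_rotation (x * sin theta) (y * sin theta) mh h0.
  rewrite !exprMn -mulrDl sqrtrM ?addr_ge0 ?sqr_ge0// sqrtr_sqr gtr0_norm//.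
  rewrite -/s /h; under [X in _ = 2%:E * X -> _]eq_integral do rewrite mul1r.
  move=> <-; have mhxy : measurable_fun [set: R]
      (fun t => h (x * sin theta * cos t + y * sin theta * sin t)%R).
    apply: (measurableT_comp mh).
    by apply: measurable_funD; apply: measurable_funM => //;
      [exact: measurable_cos|exact: measurable_sin].
  rewrite -ge0_integralZr ?lee_fin ?(ltW st0)//; last exact: measurable_funTS.
  apply: eq_integral => phi _; rewrite -EFinM mul1r; congr (\1_A _ * _)%:E.
  by rewrite addrC !mulrA.
(* If [s = 0] the axis is the polar one and the arcsine law degenerates to a point mass. The azimuth
   then contributes only its length, [c] is 1 or -1, and [z |-> c * z] preserves []-1, 1[]. *)
have [s0|s0] := eqVneq s 0%R.
  pose G (z : R) : \bar R := (2 * pi)%:E * (\1_A (0 + c * z))%:E.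
  have mG : measurable_fun [set: R] G.
    by apply: emeasurable_funM => //; exact: m1.
  have c1_ge0 z : 0 <= (\1_A (0 + c * z))%:E :> \bar R by rewrite lee_fin.
  have pi20 : (0 <= 2 * pi :> R)%R by rewrite mulr_ge0// pi_ge0.
  rewrite (@integral_polar _ G) //; last 2 first.
  - by move=> z; rewrite mule_ge0// lee_fin.
  - move=> theta theta0; rewrite inner// s0 mul0r; congr (_ * _).
    under eq_integral do rewrite mul0r addr0.
    rewrite /G add0r (integral_cst _ _ (\1_A (c * cos theta))%:E)//=.
    rewrite lebesgue_measure_itv/= lte_fin pi_gt0 sube0 -!EFinM.
    by congr (_%:E); ring.
  have mcz := m1 0%R c.
  rewrite ge0_integralZl ?lee_fin//; last exact: measurable_funTS.
  congr (_ * _); rewrite [LHS]integral_mkcond.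
  have /orP c1 : (c == 1)%R || (c == -1)%R.
    by move: sc; rewrite s0 expr0n/= add0r => /eqP; rewrite sqrf_eq1.
  have c0 : c != 0%R by case: c1 => /eqP ->; rewrite ?oppr_eq0 oner_eq0.
  have nc : `|c|%R = 1%R by case: c1 => /eqP ->; rewrite ?normrN1 ?normr1.
  pose B := A `&` `](-1)%R, 1%R[.
  have mB : measurable B by exact: measurableI.
  transitivity (`|c|%:E * \int[mu]_z (\1_B (0 + c * z))%:E).
    rewrite nc mul1e; apply: eq_integral => z _.
    rewrite epatch_indic -EFinM /B indicI/=; congr (_ * _)%:E.
    by rewrite !indicE !mem_setE; case: c1 => /eqP ->; rewrite !in_itv/=;
      congr ((nat_of_bool _)%:R); apply/idP/idP => /andP[? ?]; apply/andP; split; lra.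
  rewrite -(@integral_affine _ 0%R c (fun z => (\1_B z)%:E))//.
    by rewrite integral_indic ?setIT.
  exact/measurable_EFinP/measurable_indic.
have s_gt0 : (0 < s)%R by rewrite lt_def s0; exact: s_ge0.
pose G (z : R) := 2%:E * \int[mu]_w F A s c (z, w).
have mF := measurable_F s c mA.
have mG : measurable_fun [set: R] G.
  apply: emeasurable_funM => //.
  by apply: (measurable_fun_fubini_tonelli_F (m2 := mu)).
rewrite (@integral_polar _ G)//; last 2 first.
- by move=> z; rewrite mule_ge0//; exact: integral_ge0.
- move=> theta theta0; rewrite inner//; congr (_ * _ * _).
  have st0 : (0 < sin theta)%R by exact: sin_gt0_pi.
  have mA1 : measurable_fun [set: R] (fun t => (\1_A t)%:E : \bar R).
    exact/measurable_EFinP/measurable_indic.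
  have A1 t : 0 <= (\1_A t)%:E :> \bar R by rewrite lee_fin.
  rewrite (integral_arcsine _ (mulr_gt0 s_gt0 st0) mA1 A1).
  apply: eq_integral => w _; rewrite -EFinM /F/= /kappa/=.
  by rewrite exprMn sin2cos2.
(* By [kappa_out] the restriction on [z] is already built into [kappa]; dropping it brings the
   integral to the form of [integral_F]. *)
have -> : \int[mu]_(z in `](-1)%R, 1%R[) G z = \int[mu]_z G z.
  rewrite integral_mkcond; apply: eq_integral => z _; rewrite patchE.
  case: ifPn => //; rewrite mem_setE sqr_lt1_itv -leNgt => z1.
  rewrite /G integral0_eq ?mule0// => w _.
  by rewrite /F kappa_out// mulr0.
rewrite ge0_integralZl//; last 2 first.
- by apply: (measurable_fun_fubini_tonelli_F (m2 := mu)).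
- by move=> z _; exact: integral_ge0.
by rewrite integral_F// muleA -EFinM.
Qed.

End archimedes.

(** * Inner products with a uniform point of the sphere *)

Section sphere_law.
Local Open Scope ereal_scope.
Context {R : realType}.
Local Notation mu := (@lebesgue_measure R).
Implicit Types u v x : 'cV[R]_3.

Definition dot v x : R := (\sum_i v i 0 * x i 0)%R.

Lemma enorm_eq1 v : (enorm v = 1 <-> dot v v = 1)%R.
Proof.
rewrite /enorm (_ : (\sum_i v i 0 ^+ 2)%R = dot v v).
  have d0 : (0 <= dot v v)%R.
    by apply: sumr_ge0 => i _; rewrite -expr2 sqr_ge0.
  split=> [h|->]; last exact: sqrtr1.
  by rewrite -(sqr_sqrtr d0) h expr1n.
by apply: eq_bigr => i _; rewrite expr2.
Qed.

Lemma dot3E v x : dot v x =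
  (v 0 0 * x 0 0 + v 1 0 * x 1 0 + v 2%:R 0 * x 2%:R 0)%R.
Proof.
rewrite /dot !big_ord_recl big_ord0 addr0 addrA.
by congr (_ * _ + _ * _ + _ * _)%R; congr (_ _ 0%R); apply: val_inj.
Qed.

Lemma dot_sphere_point v theta phi : dot v (sphere_point theta phi) =
  (v 0 0 * (sin theta * cos phi) + v 1 0 * (sin theta * sin phi) +
   v 2%:R 0 * cos theta)%R.
Proof. by rewrite dot3E /sphere_point !mxE/=. Qed.

Lemma dot_sphere_point_id (theta phi : R) :
  dot (sphere_point theta phi) (sphere_point theta phi) = 1%R.
Proof.
rewrite dot_sphere_point /sphere_point !mxE/= -[RHS](cos2Dsin2 theta).
by rewrite -[in RHS](mulr1 (sin theta ^+ 2)%R) -(cos2Dsin2 phi); ring.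
Qed.

Lemma measurable_coord i : measurable_fun [set: borel3 R]
  (fun x : borel3 R => (x : 'cV[R]_3) i 0%R).
Proof.
apply: (measurability (@RGenOInfty.G R)); first exact: RGenOInfty.measurableE.
move=> _ [_ [r ->] <-]; rewrite setTI; apply: sub_sigma_algebra.
have /continuousP := @coord_continuous R 3 1 i 0%R; apply.
exact: interval_open.
Qed.

Lemma measurable_dot v :
  measurable_fun [set: borel3 R] (fun x : borel3 R => dot v x).
Proof.
apply: measurable_sum => i; apply: measurable_funM => //.
exact: measurable_coord.
Qed.

Variable m : probability (borel3 R) R.
Hypothesis mE : forall A : set (borel3 R), measurable A ->
  m A = ((4 * pi)^-1)%:E * sphere_area A.

(** A uniform law is given through areas only; this is how it yields that its points almost surely
    have norm 1. *)
Lemma sphere_law_null (N : set (borel3 R)) : measurable N ->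
  (forall theta phi, ~ N (sphere_point theta phi)) -> m N = 0.
Proof.
move=> mN N0; rewrite mE// /sphere_area integral0_eq ?mule0// => theta _.
by apply: integral0_eq => phi _; rewrite indicE memNset ?mul0r.
Qed.

Lemma sphere_law_dot v (A : set R) : dot v v = 1%R -> measurable A ->
  m ((fun x : borel3 R => dot v x) @^-1` A) =
  2^-1%:E * mu (A `&` `](-1)%R, 1%R[).
Proof.
move=> v1 mA.
have mvA : measurable ((fun x : borel3 R => dot v x) @^-1` A).
  by rewrite -[X in measurable X]setTI; exact: measurable_dot.
rewrite mE// /sphere_area.
transitivity ((4 * pi)^-1%:E * ((2 * pi)%:E * mu (A `&` `](-1)%R, 1%R[))).
  congr (_ * _); rewrite -(@sphere_projection _ (v 0 0)%R (v 1 0)%R (v 2%:R 0)%R)//.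
    apply: eq_integral => theta _; apply: eq_integral => phi _.
    by rewrite -dot_sphere_point.
  by rewrite -v1 dot3E !expr2.
rewrite muleA -EFinM; congr (_%:E * _).
by rewrite invfM mulrACA mulVf ?gt_eqF ?pi_gt0//; field.
Qed.

End sphere_law.

(** * Bilinear forms in two independent uniform points of the sphere *)

Section bilinear_form.
Local Open Scope ereal_scope.
Context {R : realType}.
Local Notation mu := (@lebesgue_measure R).
Variables (N : 'M[R]_3) (u : 'cV[R]_3) (g : R -> R).
Hypothesis u1 : dot u u = 1%R.
Hypothesis mg : measurable_fun [set: R] g.
Hypothesis g_ge0 : forall a, (0 <= g a)%R.
(** The endpoints are left out because [gain_FF] vanishes there. *)
Hypothesis g_gt0 : forall a, a \in `](-1)%R, 1%R[ -> (0 < g a)%R.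
Hypothesis gE : forall x, dot x x = 1%R ->
  dot (N *m x) (N *m x) = (g (dot u x) ^+ 2)%R.

Lemma measurable_bilinear_form :
  measurable_fun [set: borel3 R * borel3 R]
    (fun xy : borel3 R * borel3 R => dot (N *m xy.1) xy.2).
Proof.
apply: measurable_sum => i; apply: measurable_funM; last first.
  exact: (measurableT_comp (measurable_coord i) measurable_snd).
under eq_fun do rewrite mxE.
apply: measurable_sum => j; apply: measurable_funM => //.
exact: (measurableT_comp (measurable_coord j) measurable_fst).
Qed.

(* Given its first argument [x], the form is [g a] times a variable uniform
   on ]-1, 1[, where [a = u . x]. *)
Definition uniform_scale_density (a y : R) : R :=
  (2^-1 * ((g a)^-1 * (`|y| < g a)%R%:R))%R.

Lemma measurable_uniform_scale_density :
  measurable_fun [set: R * R]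
    (fun ay : R * R => uniform_scale_density ay.1 ay.2).
Proof.
have mg1 : measurable_fun [set: R * R] (fun ay : R * R => g ay.1).
  exact: (measurableT_comp mg measurable_fst).
apply: measurable_funM => //; apply: measurable_funM.
  exact: (measurableT_comp measurable_invr mg1).
rewrite (_ : (fun _ => _) = (fun ay : R * R =>
    if (`|ay.2| < g ay.1)%R then 1%R else 0%R : R)); last first.
  by apply/funext => ay; case: ifP.
apply: measurable_fun_ifT => //; apply: measurable_fun_ltr => //.
by apply: measurableT_comp => //; exact: measurable_snd.
Qed.

Lemma uniform_scale_density_ge0 a y : (0 <= uniform_scale_density a y)%R.
Proof. by rewrite !mulr_ge0// invr_ge0. Qed.

(** Archimedes' theorem applies to the unit vector [k^-1 *: v] and to the preimage [B] of [A] under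
    scaling by [k]; rescaling Lebesgue measure then widens []-1, 1[] to []-k, k[]. *)
Lemma sphere_law_scaled_dot (m : probability (borel3 R) R) (v : 'cV[R]_3)
    (k : R) (A : set R) :
  (forall A : set (borel3 R), measurable A ->
    m A = ((4 * pi)^-1)%:E * sphere_area A) ->
  (0 < k)%R -> dot v v = (k ^+ 2)%R -> measurable A ->
  m ((fun x : borel3 R => dot v x) @^-1` A) =
  \int[mu]_y (\1_A y * (2^-1 * (k^-1 * (`|y| < k)%R%:R)))%:E.
Proof.
move=> mE k0 vk mA; have kn0 : k != 0%R by rewrite gt_eqF.
pose w := (k^-1 *: v)%R.
have w1 : dot w w = 1%R.
  have -> : dot w w = (k^-1 ^+ 2 * dot v v)%R by rewrite !dot3E !mxE; ring.
  by rewrite vk -exprMn mulVf// expr1n.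
pose B := (fun t : R => 0 + k * t)%R @^-1` A.
have mB : measurable B.
  by rewrite -[B]setTI; exact: measurable_affine.
have -> : (fun x : borel3 R => dot v x) @^-1` A =
          (fun x : borel3 R => dot w x) @^-1` B.
  apply/seteqP; split => x; rewrite /B/= add0r (_ : (k * _ = dot v x)%R)//;
  by rewrite !dot3E !mxE; field.
rewrite (sphere_law_dot mE)//.
pose f y : \bar R := (\1_A y * (k^-1 * (`|y| < k)%R%:R))%:E.
have fE y : f y = (k^-1 * \1_(A `&` `](- k)%R, k[) y)%:E.
  rewrite /f indicI/= !indicE mem_setE in_itv/= -ltr_norml.
  by congr (_%:E); rewrite -?mulrA mulrCA.
have mAk : measurable (A `&` `](- k)%R, k[) by exact: measurableI.
have mf : measurable_fun [set: R] f.
  rewrite (funext fE); apply/measurable_EFinP; exact: measurable_funM.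
have f0 y : 0 <= f y by rewrite /f lee_fin !mulr_ge0// invr_ge0 ltW.
transitivity (2^-1%:E * \int[mu]_y f y); last first.
  rewrite -ge0_integralZl//.
  by apply: eq_integral => y _; rewrite /f -EFinM mulrCA.
congr (_ * _); under eq_integral do rewrite fE EFinM.
rewrite ge0_integralZl ?lee_fin ?invr_ge0 ?(ltW k0)//; last first.
  exact/measurable_EFinP/measurable_indic.
rewrite integral_indic// setIT.
rewrite [X in _ = _ * X](lebesgue_measure_affine 0%R kn0 mAk).
rewrite gtr0_norm// muleA -EFinM mulVf// mul1e; congr (mu _).
apply/seteqP; split => t; rewrite /B/= !in_itv/= add0r => -[At /andP[? ?]].
  by split => //; apply/andP; split; nra.
by split => //; apply/andP; split; nra.
Qed.

Variables m1 m2 : probability (borel3 R) R.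
Hypothesis m1E : forall A : set (borel3 R), measurable A ->
  m1 A = ((4 * pi)^-1)%:E * sphere_area A.
Hypothesis m2E : forall A : set (borel3 R), measurable A ->
  m2 A = ((4 * pi)^-1)%:E * sphere_area A.

Lemma integral_sphere_law_dot (G : R -> \bar R) :
  measurable_fun [set: R] G -> (forall a, 0 <= G a) ->
  \int[m1]_x G (dot u x) = 2^-1%:E * \int[mu]_(a in `](-1)%R, 1%R[) G a.
Proof.
move=> mG G0; pose I : set R := `](-1)%R, 1%R[%classic.
pose w (a : R) : R := (2^-1 * \1_I a)%R.
have mI0 : measurable I by exact: measurable_itv.
have mI : measurable_fun [set: R] w by exact: measurable_funM.
have I0 a : (0 <= w a)%R by rewrite mulr_ge0.
transitivity (\int[density_measure mu mI I0]_a G a).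
  rewrite (@integral_transport _ _ _ m1 (cst 1%R) _ _ _ _
    (density_measure mu mI I0) (fun x : borel3 R => dot u x))//.
  - by apply: eq_integral => x _; rewrite mule1.
  - exact: measurable_dot.
  move=> A mA; rewrite (integral_cst _ _ 1); last first.
    by rewrite -[X in measurable X]setTI; exact: measurable_dot.
  rewrite mul1e [RHS](sphere_law_dot m1E u1 mA).
  transitivity (\int[mu]_(a in A) (2^-1%:E * (\1_I a)%:E)).
    by apply: eq_integral => a _; rewrite -EFinM.
  rewrite ge0_integralZl//; last first.
    by apply: measurable_funTS; apply/measurable_EFinP; exact: measurable_indic.
  by rewrite integral_indic// setIC.
rewrite integral_density//.
rewrite -ge0_integralZl//; last exact: measurable_funTS.
rewrite [RHS]integral_mkcond; apply: eq_integral => a _.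
by rewrite epatch_indic EFinM muleCA muleA.
Qed.

(** The product measure integrates over [x] the mass of the section of the event at [x]. For almost
    every [x] that mass depends on [dot u x] alone, so the integral over the sphere becomes one over
    [a], and Tonelli brings [y] outside. *)
Lemma bilinear_form_law (A : set R) : measurable A ->
  (m1 \x m2) ((fun xy : borel3 R * borel3 R => dot (N *m xy.1) xy.2) @^-1` A) =
  \int[mu]_(y in A) (2^-1%:E *
    \int[mu]_(a in `](-1)%R, 1%R[) (uniform_scale_density a y)%:E).
Proof.
move=> mA; pose S := (fun xy : borel3 R * borel3 R => dot (N *m xy.1) xy.2) @^-1` A.
have mS : measurable S.
  by rewrite -[S]setTI; exact: measurable_bilinear_form.
pose D (ay : R * R) : \bar R :=
  (\1_A ay.2 * uniform_scale_density ay.1 ay.2)%:E.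
have mD : measurable_fun [set: R * R] D.
  apply/measurable_EFinP; apply: measurable_funM.
    by apply: measurableT_comp => //; exact: measurable_snd.
  exact: measurable_uniform_scale_density.
have D0 ay : 0 <= D ay.
  by rewrite lee_fin mulr_ge0// uniform_scale_density_ge0.
pose G a := \int[mu]_y D (a, y).
have mG : measurable_fun [set: R] G.
  by apply: (measurable_fun_fubini_tonelli_F (m2 := mu)).
have G0 a : 0 <= G a by apply: integral_ge0.
transitivity (\int[m1]_x G (dot u x)).
  apply: ge0_ae_eq_integral => //.
  - exact: measurable_fun_xsection.
  - exact: (measurableT_comp mG (measurable_dot u)).
  (* [E] collects the points where both [gE] and [g_gt0] apply. Its complement is null: non-unit
     vectors lie off the sphere, and [dot u x] almost surely lies in []-1, 1[] by Archimedes'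
     theorem. *)
  pose E : set (borel3 R) := [set x | dot x x = 1%R] `&`
    (fun x : borel3 R => dot u x) @^-1` `](-1)%R, 1%R[.
  have mdd : measurable_fun [set: borel3 R] (fun x : borel3 R => dot x x).
    by apply: measurable_sum => i; apply: measurable_funM; exact: measurable_coord.
  have mE1 : measurable [set x : borel3 R | dot x x = 1%R].
    rewrite (_ : [set x | _] = (fun x : borel3 R => dot x x) @^-1` [set 1%R])//.
    by rewrite -[X in measurable X]setTI; exact: mdd.
  have mE2 (B : set R) : measurable B ->
      measurable ((fun x : borel3 R => dot u x) @^-1` B).
    by move=> mB; rewrite -[X in measurable X]setTI; exact: measurable_dot.
  have mE : measurable E by apply: measurableI => //; exact: mE2.
  have n1 : m1 (~` [set x : borel3 R | dot x x = 1%R]) = 0.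
    apply: (sphere_law_null m1E); first exact: measurableC.
    by move=> theta phi; apply; exact: dot_sphere_point_id.
  have n2 : m1 (~` ((fun x : borel3 R => dot u x) @^-1` `](-1)%R, 1%R[)) = 0.
    rewrite preimage_setC.
    apply: (etrans (sphere_law_dot m1E u1 (measurableC _))) => //.
    by rewrite setICl measure0 mule0.
  exists (~` E); split.
  - exact: measurableC.
  - rewrite /E setCI.
    by apply: null_set_setU => //; apply: measurableC => //; exact: mE2.
  apply: subsetC => x [/= x1 xI] _.
  rewrite -[LHS]/(m2 (xsection S x)).
  have -> : xsection S x = (fun y : borel3 R => dot (N *m x) y) @^-1` A.
    by apply/seteqP; split => y; rewrite /xsection/= inE.
  rewrite (sphere_law_scaled_dot m2E (g_gt0 xI))//; exact: gE.
rewrite integral_sphere_law_dot//.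
pose I : set R := `](-1)%R, 1%R[%classic.
have mI : measurable I by exact: measurable_itv.
(* The range of [a] moves into the integrand, so that Tonelli applies on the whole plane. *)
pose K (ay : R * R) : \bar R := D ay * (\1_I ay.1)%:E.
have mK : measurable_fun [set: R * R] K.
  apply: emeasurable_funM => //; apply/measurable_EFinP.
  apply: (measurableT_comp (measurable_indic mI)).
  exact: measurable_fst.
have K0 ay : 0 <= K ay by rewrite mule_ge0// lee_fin.
have IG : \int[mu]_(a in I) G a = \int[mu]_a \int[mu]_y K (a, y).
  rewrite integral_mkcond; apply: eq_integral => a _.
  rewrite epatch_indic /K/= ge0_integralZr ?lee_fin//.
  by apply: (measurableT_comp mD); exact: pair1_measurable.
rewrite IG fubini_tonelli// [RHS]integral_mkcond -ge0_integralZl//; last 2 first.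
- exact: (measurable_fun_fubini_tonelli_G (m1 := mu)).
- by move=> y _; exact: integral_ge0.
apply: eq_integral => y _; rewrite epatch_indic -muleA; congr (_ * _).
have my : measurable_fun [set: R] (fun a => uniform_scale_density a y).
  exact: (measurableT_comp measurable_uniform_scale_density (pair2_measurable y)).
rewrite -ge0_integralZr ?lee_fin//; last 2 first.
- exact/measurable_funTS/measurable_EFinP.
- by move=> a _; rewrite lee_fin uniform_scale_density_ge0.
rewrite [RHS]integral_mkcond; apply: eq_integral => a _.
by rewrite epatch_indic /K /D/= [(\1_A y * _)%R]mulrC.
Qed.

End bilinear_form.

Section bilinear_form_pdf.
Local Open Scope ereal_scope.
Context {R : realType}.
Local Notation mu := (@lebesgue_measure R).

(** Independence is the product formula on rectangles, and this formula characterises the product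
    measure. *)
Lemma joint_law_independent d d1 d2 (T : measurableType d)
    (T1 : measurableType d1) (T2 : measurableType d2) (P : probability T R)
    (X : {RV P >-> T1}) (Y : {RV P >-> T2}) (S : set (T1 * T2)) :
  independent_RV X Y -> measurable S ->
  P ((fun w => (X w, Y w)) @^-1` S) = (distribution P X \x distribution P Y) S.
Proof.
move=> XY mS; pose phi w := (X w, Y w).
have mphi : measurable_fun [set: T] phi.
  by apply: measurable_fun_pair; exact: measurable_funP.
apply/esym.
apply: (@product_measure_unique _ _ _ _ _ (distribution P X) (distribution P Y)
  (pushforward P phi)).
- by move=> A B mA mB; exact: XY.
- by [].
Qed.

(** The last hypothesis equates extended reals, so it includes the finiteness of the inner integral;
    measurability and sign of [f] are read off from it. *)
Lemma bilinear_form_pdf d (T : measurableType d) (P : probability T R)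
    (N : 'M[R]_3) (u : 'cV[R]_3) (g f : R -> R) (X Y : {RV P >-> borel3 R}) :
  dot u u = 1%R -> measurable_fun [set: R] g -> (forall a, (0 <= g a)%R) ->
  (forall a, a \in `](-1)%R, 1%R[ -> (0 < g a)%R) ->
  (forall x, dot x x = 1%R -> dot (N *m x) (N *m x) = (g (dot u x) ^+ 2)%R) ->
  uniform_on_sphere X -> uniform_on_sphere Y -> independent_RV X Y ->
  (forall y, (f y)%:E = 2^-1%:E *
    \int[mu]_(a in `](-1)%R, 1%R[) (uniform_scale_density g a y)%:E) ->
  has_pdf P (fun w => dot (N *m X w) (Y w)) f.
Proof.
move=> u1 mg g_ge0 g_gt0 gE hX hY XY fE.
pose I : set R := `](-1)%R, 1%R[%classic.
pose K (ay : R * R) : \bar R :=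
  (uniform_scale_density g ay.1 ay.2)%:E * (\1_I ay.1)%:E.
have mK : measurable_fun [set: R * R] K.
  apply: emeasurable_funM; apply/measurable_EFinP.
    exact: measurable_uniform_scale_density.
  have mI : measurable I by exact: measurable_itv.
  apply: (measurableT_comp (measurable_indic mI)).
  exact: measurable_fst.
have K0 ay : 0 <= K ay.
  by rewrite mule_ge0// lee_fin// uniform_scale_density_ge0.
have fK y : (f y)%:E = 2^-1%:E * \int[mu]_a K (a, y).
  rewrite fE integral_mkcond; congr (_ * _); apply: eq_integral => a _.
  by rewrite epatch_indic.
split.
- have mXY : measurable_fun [set: T] (fun w => (X w, Y w)).
    by apply: measurable_fun_pair; exact: measurable_funP.
  exact: (measurableT_comp (measurable_bilinear_form N) mXY).
- apply/measurable_EFinP.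
  rewrite (_ : EFin \o f = fun y => 2^-1%:E * \int[mu]_a K (a, y)).
    apply: emeasurable_funM => //.
    exact: (measurable_fun_fubini_tonelli_G (m1 := mu)).
  by apply/funext => y; rewrite /= fK.
- move=> y; rewrite -lee_fin fK mule_ge0//.
  exact: integral_ge0.
- move=> A mA; pose S :=
    (fun xy : borel3 R * borel3 R => dot (N *m xy.1) xy.2) @^-1` A.
  have mS : measurable S.
    by rewrite -[S]setTI; exact: measurable_bilinear_form.
  rewrite -[LHS]/(P ((fun w => (X w, Y w)) @^-1` S)).
  rewrite (joint_law_independent XY mS).
  rewrite (bilinear_form_law u1 mg g_ge0 g_gt0 gE hX hY mA).
  by apply: eq_integral => y _; rewrite fE.
Qed.

End bilinear_form_pdf.

(** * The near-field and far-field densities *)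

(* The norm of the image of a unit vector [x] under the near-field matrix (resp.
   the far-field one), as a function of [a = u . x]. *)
Definition gain_NF (R : realType) (a : R) : R := Num.sqrt (1 + 3 * a ^+ 2) / 2.

Definition gain_FF (R : realType) (a : R) : R := Num.sqrt (1 - a ^+ 2).

Section densities.
Local Open Scope ereal_scope.
Context {R : realType}.
Local Notation mu := (@lebesgue_measure R).

Lemma integral_even (f : R -> \bar R) : measurable_fun [set: R] f ->
  (forall x, 0 <= f x) -> (forall x, f (- x)%R = f x) ->
  \int[mu]_(x in `](-1)%R, 1%R[) f x = 2%:E * \int[mu]_(x in `]0%R, 1%R[) f x.
Proof.
move=> mf f0 fN.
rewrite -(@integral_itv_bndoo _ _ _ _ true true); last exact: measurable_funTS.
rewrite (@ge0_integral_itv_split _ _ 0%R)//; last by rewrite lerN10 ler01.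
rewrite (@ge0_integral_affine_in _ 0%R (-1)%R `[(-1)%R, 0%R[%classic)//.
rewrite normrN1 mul1e (_ : _ @^-1` _ = `]0%R, 1%R]%classic); last first.
  by apply/seteqP; split => t; rewrite /= !in_itv/= => /andP[? ?];
    apply/andP; split; lra.
under [X in X + _]eq_integral do rewrite add0r mulN1r fN.
rewrite [X in X + _]integral_itv_bndoo; last exact: measurable_funTS.
rewrite [X in _ + X]integral_itv_bndoo; last exact: measurable_funTS.
by rewrite -[X in X + _]mul1e -[X in _ + X]mul1e -ge0_muleDl// -EFinD.
Qed.

Let q (a : R) : R := Num.sqrt (1 + 3 * a ^+ 2).

Let q_gt0 a : (0 < q a)%R.
Proof. by rewrite sqrtr_gt0; have := sqr_ge0 a; lra. Qed.

Let q2 a : (q a ^+ 2 = 1 + 3 * a ^+ 2)%R.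
Proof. by rewrite sqr_sqrtr//; have := sqr_ge0 a; lra. Qed.

(* An antiderivative of [1 / q]. *)
Let H (a : R) : R := (ln (Num.sqrt 3 * a + q a) / Num.sqrt 3)%R.

Let sqrt3_gt0 : (0 < Num.sqrt 3 :> R)%R. Proof. by rewrite sqrtr_gt0. Qed.

Let sqrt3_sqr : (Num.sqrt 3 ^+ 2 = 3 :> R)%R. Proof. by rewrite sqr_sqrtr. Qed.

(** The square of [q a] exceeds that of [Num.sqrt 3 * a] by 1, so [q a] dominates even for negative
    [a]. *)
Let H_arg_gt0 a : (0 < Num.sqrt 3 * a + q a)%R.
Proof.
rewrite ltNge; apply/negP => h.
have h' : (q a <= - (Num.sqrt 3 * a))%R by lra.
have : (q a ^+ 2 <= (- (Num.sqrt 3 * a)) ^+ 2)%R.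
  by rewrite ler_sqr// nnegrE ltW ?(lt_le_trans (q_gt0 a)).
by rewrite q2 sqrrN exprMn sqrt3_sqr; lra.
Qed.

Let is_derive_H (a : R) : is_derive a 1%R H (q a)^-1%R.
Proof.
have d1 : is_derive a 1%R (fun x : R => 1 + 3 * x ^+ 2)%R (6 * a)%R.
  by apply: is_derive_eq; rewrite /GRing.scale/=; ring.
have dq : is_derive a 1%R q ((2 * q a)^-1 * (6 * a))%R.
  apply: (@is_derive1_comp _ (@Num.sqrt R)) => //.
  by apply: is_derive1_sqrt; have := sqr_ge0 a; lra.
have d2 : is_derive a 1%R (fun x : R => Num.sqrt 3 * x + q x)%R
    (Num.sqrt 3 + (2 * q a)^-1 * (6 * a))%R.
  by apply: is_derive_eq; rewrite /GRing.scale/= mulr1.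
have d3 := @is_derive1_comp _ (@ln R) (fun x => Num.sqrt 3 * x + q x)%R a _ _
  (is_derive1_ln (H_arg_gt0 a)) d2.
rewrite /H; apply: is_derive_eq.
rewrite /GRing.scale/=.
have q0 : q a != 0%R by rewrite gt_eqF.
have s0 : (Num.sqrt 3 != 0 :> R)%R by rewrite gt_eqF.
have h0 : (Num.sqrt 3 * a + q a != 0)%R by rewrite gt_eqF.
(* With 3 written as the square of [s = Num.sqrt 3], the numerator [s + s^2 a / q] has the factor
   [s a + q], and the identity becomes purely rational in [s] and [q]. *)
rewrite !mulr0 add0r (_ : 6 * a = 2 * Num.sqrt 3 ^+ 2 * a)%R; last first.
  by rewrite sqrt3_sqr; ring.
move: s0 q0 h0; generalize (Num.sqrt 3 : R) (q a) => s t s0 q0 h0.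
by field; rewrite h0 s0 q0.
Qed.

Let integral_q (b : R) : (b < 1)%R ->
  \int[mu]_(a in `]b, 1%R[) ((q a)^-1)%:E = (H 1 - H b)%:E.
Proof.
move=> b1; have cH : continuous H.
  move=> a; apply/differentiable_continuous/derivable1_diffP.
  by case: (is_derive_H a).
have cq : continuous (fun a => (q a)^-1)%R.
  move=> a; apply: cvgV; first by rewrite gt_eqF.
  apply: (@continuous_comp _ _ _ (fun a : R => 1 + 3 * a ^+ 2)%R (@Num.sqrt R)).
    apply: cvgD; first exact: cvg_cst.
    by apply: cvgM; [exact: cvg_cst|exact: exprn_continuous].
  exact: sqrt_continuous.
rewrite -(@integral_itv_bndoo _ _ _ _ true false); last first.
  apply: measurable_funTS; apply/measurable_EFinP.
  exact: (continuous_measurable_fun cq).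
rewrite (@continuous_FTC2 _ _ H)//.
- exact: continuous_subspaceT.
- split => [x _||].
  + by case: (is_derive_H x).
  + by apply: cvg_at_right_filter; exact: cH.
  + by apply: cvg_at_left_filter; exact: cH.
- by move=> x _; rewrite derive1E; case: (is_derive_H x).
Qed.

(** The constant [arcosh 2] arises here: [q 1 = 2] and [3 = 2^2 - 1]. *)
Let H1E : H 1 = (arcosh 2 / Num.sqrt 3)%R.
Proof.
rewrite /H /arcosh; congr (ln _ / _)%R; rewrite mulr1 addrC; congr (_ + _)%R.
  rewrite /q (_ : 1 + 3 * 1 ^+ 2 = 2 ^+ 2)%R; last by ring.
  by rewrite sqrtr_sqr ger0_norm.
by congr (Num.sqrt _); ring.
Qed.

(* For [a > 0], the condition [|y| < gain_NF a] reads [threshold y < a]; the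
   square root of a negative number is 0, which covers the case [|y| < 1/2]. *)
Let threshold (y : R) : R := Num.sqrt ((4 * y ^+ 2 - 1) / 3).

Let thresholdP (a y : R) : (0 < a)%R -> (`|y| < gain_NF a)%R = (threshold y < a)%R.
Proof.
move=> a0; rewrite /gain_NF ltr_pdivlMr// -[X in (_ < X)%R]/(q a).
have -> : (`|y| * 2 < q a)%R = (4 * y ^+ 2 < 1 + 3 * a ^+ 2)%R.
  rewrite -(@ltr_pXn2r _ 2)// ?nnegrE ?mulr_ge0 ?sqrtr_ge0//.
  by rewrite q2 exprMn real_normK ?num_real//; congr (_ < _)%R; ring.
have [y0|y0] := leP (4 * y ^+ 2 - 1)%R 0%R.
  rewrite /threshold ler0_sqrtr ?pmulr_lle0 ?invr_gt0// a0.
  by have := exprn_gt0 2 a0; lra.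
rewrite -[RHS]ltr_sqr ?nnegrE ?sqrtr_ge0 ?(ltW a0)//.
rewrite sqr_sqrtr ?divr_ge0 ?(ltW y0)//.
by apply/idP/idP => ?; lra.
Qed.

(** For [|y| > 1/2] the gain at the threshold is [|y|], so [q] equals [2 |y|] there, while
    [Num.sqrt 3 * threshold y] is [sqrt (4 y^2 - 1)]; their sum is the argument of the logarithm in
    [arcosh (2 |y|)]. Otherwise the threshold is 0 and [ln 1 = 0]. *)
Let H_threshold (y : R) : H (threshold y) =
  if (`|y| <= 2^-1)%R then 0%R else (arcosh (2 * `|y|) / Num.sqrt 3)%R.
Proof.
case: ifPn => [y2|].
  have y2' : (`|y| ^+ 2 <= 2^-1 ^+ 2)%R by rewrite ler_sqr ?nnegrE.
  move: y2'; rewrite real_normK ?num_real// => y2'.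
  rewrite /threshold ler0_sqrtr; last first.
    by rewrite pmulr_lle0 ?invr_gt0//; lra.
  by rewrite /H /q mulr0 expr0n/= mulr0 addr0 sqrtr1 add0r ln1 mul0r.
rewrite -ltNge => y2.
have y2' : (2^-1 ^+ 2 < `|y| ^+ 2)%R by rewrite ltr_sqr ?nnegrE// ltW// (le_lt_trans _ y2).
move: y2'; rewrite real_normK ?num_real// => y2'.
have y4 : (0 <= 4 * y ^+ 2 - 1)%R by lra.
have t3 : (0 <= (4 * y ^+ 2 - 1) / 3)%R by rewrite divr_ge0.
rewrite /H /arcosh; congr (ln _ / _)%R; rewrite addrC; congr (_ + _)%R.
  rewrite /q sqr_sqrtr// (_ : 1 + _ = (2 * `|y|) ^+ 2)%R.
    by rewrite sqrtr_sqr ger0_norm// mulr_ge0.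
  by rewrite exprMn real_normK ?num_real//; field.
rewrite -sqrtrM//; congr Num.sqrt.
by rewrite exprMn real_normK ?num_real//; field.
Qed.

Let arcosh2_gt0 : (0 < arcosh 2 :> R)%R.
Proof.
rewrite /arcosh ln_gt0//; have := sqrtr_ge0 (2 ^+ 2 - 1 : R)%R; lra.
Qed.

Lemma measurable_gain_NF : measurable_fun [set: R] (@gain_NF R).
Proof.
apply: measurable_funM => //; apply: (measurableT_comp measurable_sqrtr).
by apply: measurable_funD => //; apply: measurable_funM.
Qed.

Lemma measurable_gain_FF : measurable_fun [set: R] (@gain_FF R).
Proof.
apply: (measurableT_comp measurable_sqrtr).
by apply: measurable_funB => //; exact: measurable_funX.
Qed.

Lemma gain_NF_gt0 (a : R) : (0 < gain_NF a)%R.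
Proof. by apply: divr_gt0 => //; exact: q_gt0. Qed.

Lemma gain_FF_gt0 (a : R) : a \in `](-1)%R, 1%R[ -> (0 < gain_FF a)%R.
Proof.
by rewrite in_itv/= sqrtr_gt0 => /andP[? ?]; nra.
Qed.

Lemma gain_NF_lt1 (a : R) : a \in `]0%R, 1%R[ -> (gain_NF a < 1)%R.
Proof.
rewrite in_itv/= => /andP[? ?]; rewrite /gain_NF ltr_pdivrMr// mul1r.
rewrite -[ltRHS]ger0_norm// -sqrtr_sqr ltr_sqrt//; nra.
Qed.

(** Evenness in [a] cancels the outer 1/2, and the inner 1/2 cancels the denominator of [gain_NF].
    For [|y| < 1] this leaves the integral of [1 / q] from [threshold y] to 1; for [|y| >= 1] the
    integrand is 0. *)
Lemma f_NF_integral (y : R) : (f_NF y)%:E = 2^-1%:E *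
  \int[mu]_(a in `](-1)%R, 1%R[) (uniform_scale_density (@gain_NF R) a y)%:E.
Proof.
have mphi : measurable_fun [set: R]
    (fun a => (uniform_scale_density (@gain_NF R) a y)%:E).
  apply/measurable_EFinP.
  exact: (measurableT_comp
    (measurable_uniform_scale_density measurable_gain_NF) (pair2_measurable y)).
rewrite integral_even//; last 2 first.
- move=> a; rewrite lee_fin uniform_scale_density_ge0// => b.
  exact/ltW/gain_NF_gt0.
- by move=> a; rewrite /uniform_scale_density /gain_NF sqrrN.
rewrite muleA -EFinM mulVf// mul1e.
have [y1|y1] := ltP `|y|%R 1%R; last first.
  rewrite integral0_eq; last first.
    move=> a aI; rewrite /uniform_scale_density ltNge.
    by rewrite (le_trans (ltW (gain_NF_lt1 aI)) y1)/= !mulr0.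
  rewrite /f_NF ltNge y1/= ifF ?mulr0//.
  by apply/negbTE; rewrite -ltNge (lt_le_trans _ y1)// invf_lt1// ltr1n.
(* By [thresholdP] at [a = 1], this is [|y| < gain_NF 1 = 1]. *)
have t1 : (threshold y < 1)%R.
  rewrite -thresholdP// /gain_NF (_ : 1 + 3 * 1 ^+ 2 = 2 ^+ 2)%R; last by ring.
  by rewrite sqrtr_sqr normr_nat divff.
have t0 : (0 <= threshold y)%R by exact: sqrtr_ge0.
transitivity (\int[mu]_(a in `]threshold y, 1%R[) ((q a)^-1)%:E).
  rewrite integral_q// H1E H_threshold /f_NF y1 /beta_bar; congr (_%:E).
  have a0 : (arcosh 2 != 0 :> R)%R by rewrite gt_eqF.
  have s0 : (Num.sqrt 3 != 0 :> R)%R by rewrite gt_eqF.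
  move: a0 s0; generalize (Num.sqrt 3 : R) (arcosh 2 : R) => s b a0 s0.
  by case: ifP => _; field; rewrite a0 s0.
rewrite [LHS]integral_mkcond [RHS]integral_mkcond; apply: eq_integral => a _.
rewrite !patchE !mem_setE !in_itv/=; case: (ltP 0%R a) => a0/=; last first.
  by rewrite ltNge (le_trans a0 t0).
case: ifPn => [|]; rewrite -thresholdP//.
  move=> /andP[ya ->]; rewrite /uniform_scale_density ya mulr1 /gain_NF.
  by congr (_%:E); rewrite invf_div mulrA mulVf// mul1r.
case: ifPn => // a1; rewrite andbT => /negbTE ya.
by rewrite /uniform_scale_density ya !mulr0.
Qed.

(** The sine increases on [[0, pi / 2]], and [t |-> pi - t] reflects the other half onto it. *)
Let sin_gt_itv (b x : R) : (0 <= b < 1)%R ->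
  (x \in `]0%R, pi[) && (b < sin x)%R = (x \in `]asin b, (pi - asin b)%R[).
Proof.
move=> /andP[b0 b1]; have bI : (-1 <= b <= 1)%R by apply/andP; split; lra.
have p0 := pi_gt0 R.
have sb : sin (asin b) = b by rewrite asinK// in_itv.
have [l u] : (- (pi / 2) <= asin b)%R /\ (asin b <= pi / 2)%R.
  by rewrite asin_geNpi2 ?asin_lepi2.
have a0 : (0 <= asin b)%R.
  rewrite leNgt; apply/negP => h.
  have : (sin (asin b) < sin 0)%R.
    by rewrite ltr_sin// in_itv/=; apply/andP; split; lra.
  by rewrite sb sin0 ltNge b0.
have sinC (t : R) : sin (pi - t)%R = sin t by rewrite sinB sinpi cospi; ring.
have key (t : R) : (0 <= t <= pi / 2)%R -> (b < sin t)%R = (asin b < t)%R.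
  move=> /andP[? ?]; rewrite -[in LHS]sb ltr_sin// in_itv/=;
  by apply/andP; split; lra.
rewrite !in_itv/=; have [xp|xp] := leP x (pi / 2)%R.
  have [x0|x0] := ltP 0%R x; last first.
    by rewrite /=; apply/esym/negbTE; rewrite negb_and -!leNgt (le_trans x0 a0).
  rewrite key ?(ltW x0)//= (_ : (x < pi)%R)/=; last by lra.
  by apply/idP/andP => [?|[]//]; split => //; lra.
rewrite -sinC; have [x1|x1] := ltP x pi; last first.
  rewrite andbF/=; apply/esym/negbTE; rewrite negb_and -!leNgt.
  by apply/orP; right; lra.
rewrite key; last by apply/andP; split; lra.
by apply/idP/idP => /andP[? ?]; repeat (apply/andP; split); lra.
Qed.

(** After [a = cos x] what remains is a quarter of the measure of [B], an interval of length
    [pi - 2 asin |y|] when [|y| < 1]. *)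
Lemma f_FF_integral (y : R) : (f_FF y)%:E = 2^-1%:E *
  \int[mu]_(a in `](-1)%R, 1%R[) (uniform_scale_density (@gain_FF R) a y)%:E.
Proof.
have gain_ge0 (a : R) : (0 <= gain_FF a)%R by exact: sqrtr_ge0.
rewrite (@integral_cos_sin _ (fun a => (uniform_scale_density _ a y)%:E)); last 2 first.
- apply/measurable_EFinP; exact: (measurableT_comp
    (measurable_uniform_scale_density measurable_gain_FF) (pair2_measurable y)).
- by move=> a; rewrite lee_fin uniform_scale_density_ge0.
pose B : set R := `]0%R, pi[ `&` [set x | `|y| < sin x]%R.
have mB : measurable B.
  apply: measurableI => //.
  rewrite (_ : [set x | _] = (@sin R) @^-1` `]`|y|%R, +oo[); last first.
    by apply/seteqP; split => x /=; rewrite in_itv/= andbT.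
  by rewrite -[X in measurable X]setTI; exact: measurable_sin.
transitivity (2^-1%:E * (2^-1%:E * mu B)); last first.
  congr (_ * _).
  transitivity (\int[mu]_x (2^-1%:E * (\1_B x)%:E)).
    rewrite ge0_integralZl//; last exact/measurable_EFinP/measurable_indic.
    by rewrite integral_indic// setIT.
  rewrite [RHS]integral_mkcond; apply: eq_integral => x _.
  rewrite patchE; case: ifPn => xI.
    have x0 : x \in `]0%R, pi[ by rewrite inE in xI.
    have sx : (0 < sin x)%R by exact: sin_gt0_pi.
    rewrite /uniform_scale_density /gain_FF -sin2cos2 sqrtr_sqr gtr0_norm//.
    rewrite -!EFinM; congr (_%:E); rewrite -!mulrA; congr (_ * _)%R.
    rewrite mulrCA mulVf ?gt_eqF// mulr1 indicE; congr ((nat_of_bool _)%:R).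
    by apply/idP/idP => [|yx]; rewrite inE => // -[].
  rewrite indicE (_ : x \in B = false) ?mule0//.
  by apply: contraNF xI; rewrite !inE => -[].
have [y1|y1] := ltP `|y|%R 1%R; last first.
  rewrite (_ : B = set0); last first.
    apply/seteqP; split => // x [_ /= yx].
    by have := lt_le_trans (le_lt_trans y1 yx) (sin_le1 x); rewrite ltxx.
  (* The first branch of [f_FF] includes [|y| = 1], where its formula gives 0 because
     [asin 1 = pi / 2]. *)
  rewrite measure0 !mule0 /f_FF; case: ifPn => // yI.
  have -> : `|y|%R = 1%R by apply/le_anti; rewrite y1 ler_norml yI.
  rewrite -[X in asin X](@sin_pihalf R) sinK ?subrr ?mulr0//.
  by rewrite in_itv/=; have := pi_gt0 R => ?; apply/andP; split; lra.
have -> : B = `]asin `|y|, (pi - asin `|y|)%R[%classic.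
  have yI : (0 <= `|y| < 1)%R by rewrite normr_ge0.
  apply/seteqP; split => x; rewrite /B/=.
    by move=> [x0 yx]; rewrite -sin_gt_itv// x0.
  by rewrite -sin_gt_itv// => /andP.
rewrite lebesgue_measure_itv/= lte_fin.
have yp : (asin `|y| < pi / 2)%R.
  by rewrite asin_ltpi2// y1 andbT (le_trans _ (normr_ge0 y))// lerN10.
rewrite ifT; last by lra.
rewrite -EFinB -!EFinM /f_FF ifT; last first.
  by rewrite -ler_norml ltW.
congr (_%:E); generalize (pi : R) (asin `|y|) => p s; by field.
Qed.

End densities.

(** * The two alignment matrices and their gains *)

Section alignment.
Context {R : realType}.
Implicit Types u x y z : 'cV[R]_3.

Lemma bilinear_formE (N : 'M[R]_3) x y : (y^T *m N *m x) 0 0 = dot (N *m x) y.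
Proof.
by rewrite -mulmxA mxE; apply: eq_bigr => i _; rewrite [y^T _ _]mxE mulrC.
Qed.

Lemma projection_coord u x i : (u *m u^T *m x) i 0 = dot u x * u i 0.
Proof.
rewrite -mulmxA mxE big_ord1 mulrC; congr (_ * _).
by rewrite mxE; apply: eq_bigr => j _; rewrite mxE.
Qed.

(** Both matrices send [x] to a combination of [u] and [x], which is why the norm of the image
    depends on a unit vector [x] only through [dot u x]. *)
Lemma dot_comb (a b : R) u x z : (forall i, z i 0 = a * u i 0 + b * x i 0) ->
  dot z z = a ^+ 2 * dot u u + 2 * a * b * dot u x + b ^+ 2 * dot x x.
Proof. by move=> zE; rewrite !dot3E !zE; ring. Qed.

Lemma dot_NF u x : dot u u = 1 -> dot x x = 1 ->
  let z := 2^-1 *: (3 *: (u *m u^T) - 1%:M) *m x in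
  dot z z = gain_NF (dot u x) ^+ 2.
Proof.
(* With [a = dot u x] the squared norm is [9/4 a^2 - 3/2 a^2 + 1/4 = (1 + 3 a^2) / 4]. *)
move=> u1 x1 z; rewrite (@dot_comb (3 / 2 * dot u x) (- 2^-1) u x) => [|i].
  rewrite u1 x1 /gain_NF expr_div_n sqr_sqrtr; first by field.
  by have := sqr_ge0 (dot u x); lra.
rewrite /z -scalemxAl mulmxBl -scalemxAl mul1mx !mxE.
have := projection_coord u x i; rewrite mxE => ->.
by field.
Qed.

Lemma dot_FF u x : dot u u = 1 -> dot x x = 1 ->
  let z := (1%:M - u *m u^T) *m x in dot z z = gain_FF (dot u x) ^+ 2.
Proof.
move=> u1 x1 z.
have zz : dot z z = 1 - dot u x ^+ 2.
  rewrite (@dot_comb (- dot u x) 1 u x) => [|i].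
    by rewrite u1 x1; ring.
  rewrite /z mulmxBl mul1mx !mxE.
  have := projection_coord u x i; rewrite mxE => ->.
  by ring.
(* Nonnegativity of [1 - (dot u x)^2], a case of Cauchy-Schwarz, is read off from its being the sum
   of squares [dot z z]. *)
rewrite /gain_FF sqr_sqrtr ?zz// -zz.
by apply: sumr_ge0 => i _; rewrite -expr2 sqr_ge0.
Qed.

End alignment.

Theorem proposition1 (R : realType) (d : measure_display)
    (Omega : measurableType d) (P : probability Omega R)
    (u : 'cV[R]_3) (oT oR : {RV P >-> borel3 R})
    (hu : enorm u = 1)
    (hT : uniform_on_sphere oT) (hR : uniform_on_sphere oR)
    (hindep : independent_RV oT oR) :
  has_pdf P (fun w => J_NF u (oT w) (oR w)) (@f_NF R) /\
  has_pdf P (fun w => J_FF u (oT w) (oR w)) (@f_FF R).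
Proof.
have u1 := (enorm_eq1 u).1 hu; split.
- under eq_fun do rewrite /J_NF bilinear_formE.
  apply: (bilinear_form_pdf u1 measurable_gain_NF _ _ _ hT hR hindep) => [a|a _|x|y].
  + exact/ltW/gain_NF_gt0.
  + exact: gain_NF_gt0.
  + exact: dot_NF.
  + exact: f_NF_integral.
- under eq_fun do rewrite /J_FF bilinear_formE.
  apply: (bilinear_form_pdf u1 measurable_gain_FF _ _ _ hT hR hindep) => [a|a|x|y].
  + exact: sqrtr_ge0.
  + exact: gain_FF_gt0.
  + exact: dot_FF.
  + exact: f_FF_integral.
Qed.
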